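(* Assume there is $K>0$ such that $a_{j,k}\le Kjk$ for all $j,k\in\mathbb N$, and let $c=(c_j)$ be an admissible solution of the RBK system (on $[0,\infty)$). Then the functions $t\mapsto c_j(t)$, for $j\in\mathbb N$, and $t\mapsto\sum_{j=1}^\infty c_j(t)$ are continuously differentiable on $[0,\infty)$. Moreover, the RBK system $$\frac{dc_j}{dt}(t)=\sum_{k=1}^\infty a_{j+k,k}c_{j+k}(t)c_k(t)-\sum_{k=1}^\infty a_{j,k}c_j(t)c_k(t),\qquad j\in\mathbb N,$$ is satisfied for all $t\in[0,\infty)$, and $$\frac{d}{dt}\sum_{j=1}^\infty c_j(t)=-\sum_{k=1}^\infty\sum_{j=1}^k a_{j,k}c_j(t)c_k(t)\qquad\text{for all }t\in[0,+\infty).$$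
   Context: The rate coefficients $a_{j,k}$ ($j,k\in\mathbb N=\{1,2,\dots\}$) are real with $a_{j,k}=a_{k,j}\ge 0$. The Redner--Ben-Avraham--Kahng (RBK) system is $$\frac{dc_j}{dt}=\sum_{k=1}^\infty a_{j+k,k}c_{j+k}c_k-\sum_{k=1}^\infty a_{j,k}c_jc_k,\qquad j\in\mathbb N.$$ $X_1=\{x=(x_j)\in\mathbb R^{\mathbb N}: \|x\|_1:=\sum_{j=1}^\infty j|x_j|<\infty\}$ and $X_1^+=\{x\in X_1: x_j\ge 0\ \forall j\}$. Definition (solution). Let $T\in(0,+\infty]$. A (mild) solution of the RBK system on $[0,T)$ with $c(0)=c_0\in X_1^+$ is a function $c=(c_j):[0,T)\to X_1^+$ such that: (i) each $c_j:[0,T)\to[0,\infty)$ is continuous and $\sup_{t\in[0,T)}\|c(t)\|_1<\infty$; (ii) for all $j\in\mathbb N$ and $t\in[0,T)$, $\int_0^t\sum_{k=1}^\infty a_{j,k}c_k(s)\,ds<\infty$; (iii) for all $j\in\mathbb N$ and $t\in[0,T)$, $$c_j(t)=c_{0j}+\int_0^t\Big[\sum_{k=1}^\infty a_{j+k,k}c_{j+k}(s)c_k(s)-\sum_{k=1}^\infty a_{j,k}c_j(s)c_k(s)\Big]ds.$$ A solution $c$ on $[0,\infty)$ is admissible if it is the limit as $N\to\infty$, uniformly (in the norm $\|\cdot\|_1$) on compact subsets of $[0,\infty)$, of a sequence of solutions $c^N$ of the RBK system on $[0,\infty)$ such that $c^N_j\equiv 0$ for all $j>N$. Derivatives at $t=0$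 are one-sided. *)

(* Defs.v *)
From mathcomp Require Import all_boot all_order all_algebra.
From mathcomp Require Import all_classical all_reals all_analysis.

Set Implicit Arguments.
Unset Strict Implicit.
Unset Printing Implicit Defensive.

Import Order.TTheory GRing.Theory Num.Theory numFieldNormedType.Exports.
Local Open Scope classical_set_scope.
Local Open Scope ring_scope.

(* A sequence (x_j), j = 1, 2, ..., is a function x : nat -> R whose value at
   the index 0 is never used.  Infinite sums are taken in \bar R and only
   used where their terms are nonnegative, so a finite sum is a convergent
   series. *)

Definition norm1 (R : realType) (x : nat -> R) : \bar R :=
  (\sum_(1 <= j <oo) (j%:R * `|x j|)%:E)%E.

Definition X1 (R : realType) : set (nat -> R) :=
  [set x | (norm1 x < +oo)%E].

Definition X1plus (R : realType) : set (nat -> R) :=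
  [set x | X1 x /\ forall j, (0 < j)%N -> 0 <= x j].

Definition rate_coefficients (R : realType) (a : nat -> nat -> R) : Prop :=
  forall j k, (0 < j)%N -> (0 < k)%N -> a j k = a k j /\ 0 <= a j k.

Definition RBK_rhs (R : realType) (a : nat -> nat -> R) (x : nat -> R)
    (j : nat) : \bar R :=
  (\sum_(1 <= k <oo) (a (j + k)%N k * x (j + k)%N * x k)%:E
   - \sum_(1 <= k <oo) (a j k * x j * x k)%:E)%E.

Definition time_dom (R : realType) (T : \bar R) : set R :=
  [set t | 0 <= t /\ (t%:E < T)%E].

(* In the last clause the left-hand side is finite; as +oo - +oo = -oo in
   \bar R, the equality forces the positive and negative parts of the
   integrand to have finite integrals. *)
Definition is_solution (R : realType) (a : nat -> nat -> R) (T : \bar R)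
    (c0 : nat -> R) (c : R -> nat -> R) : Prop :=
  [/\ (0 < T)%E,
      X1plus c0,
      (forall t, time_dom T t -> X1plus (c t)),
      (forall j, (0 < j)%N -> {within time_dom T, continuous (c ^~ j)})
        /\ (ereal_sup [set norm1 (c t) | t in time_dom T] < +oo)%E
    & (forall j t, (0 < j)%N -> time_dom T t ->
        (\int[lebesgue_measure]_(s in `[0%R, t])
           (\sum_(1 <= k <oo) (a j k * c s k)%:E) < +oo)%E)
      /\
      (forall j t, (0 < j)%N -> time_dom T t ->
        ((c t j)%:E = (c0 j)%:E
           + \int[lebesgue_measure]_(s in `[0%R, t]) RBK_rhs a (c s) j)%E)].

Definition global_solution (R : realType) (a : nat -> nat -> R)
    (c : R -> nat -> R) : Prop :=
  exists c0 : nat -> R, is_solution a +oo%E c0 c.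

Definition cvg_norm1_compacts (R : realType) (cN : nat -> R -> nat -> R)
    (c : R -> nat -> R) : Prop :=
  forall B : set R, compact B -> B `<=` `[0, +oo[ ->
  forall e : R, 0 < e ->
  \forall N \near \oo, forall t, B t ->
    (norm1 (fun j => (cN N t j - c t j)%R) < e%:E)%E.

Definition admissible (R : realType) (a : nat -> nat -> R)
    (c : R -> nat -> R) : Prop :=
  global_solution a c /\
  exists cN : nat -> R -> nat -> R,
    [/\ (forall N, (0 < N)%N -> global_solution a (cN N)),
        (forall N j t, (0 < N)%N -> (N < j)%N -> 0 <= t -> cN N t j = 0)
      & cvg_norm1_compacts cN c].

(* Differentiability on [0, +oo[, one-sided at 0; the values of f at negative
   arguments are irrelevant. *)
Definition is_derive_nneg (R : realType) (f : R -> R) (t d : R) : Prop :=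
  [/\ 0 <= t,
      (0 < t -> is_derive t 1 f d)
    & (t = 0 -> h^-1 * (f h - f 0) @[h --> 0^'+] --> d)].

Definition C1_nneg (R : realType) (f : R -> R) : Prop :=
  exists df : R -> R,
    (forall t, 0 <= t -> is_derive_nneg f t (df t)) /\
    {within `[0, +oo[, continuous df}.

(* The sum is finite, and [fine] harmless, when c t is in X1plus. *)
Definition total_number (R : realType) (c : R -> nat -> R) (t : R) : R :=
  fine (\sum_(1 <= j <oo) (c t j)%:E)%E.

(* Main.v *)
(* An admissible solution is a locally uniform limit, in the norm of X_1, of
   solutions c^N supported in {1, ..., N}; hence the tails sum_(k > N) k c_k(t)
   are at most ||c^N(t) - c(t)||_1 and tend to 0 uniformly on compact time
   intervals.  As a_(j,k) c_j c_k <= K (j c_j) (k c_k), every series in the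
   system, and the one giving the derivative of the total number, is then a
   locally uniform limit of continuous functions.  The integral equation thus
   has a continuous integrand and c_j is C^1.  Summing the integral equations
   over j < n and letting n -> oo by dominated convergence gives an integral
   equation for sum_j c_j, in which the total gain sum_(j,k) a_(j+k,k) c_(j+k) c_k
   cancels the part j > k of the total loss sum_(j,k) a_(j,k) c_j c_k.

   Paths are extended to negative times by s |-> c (max 0 s), so that
   continuity is always on the whole line. *)

Require Import Defs.
From mathcomp Require Import all_boot all_order all_algebra.
From mathcomp Require Import all_classical all_reals all_analysis.
From mathcomp Require Import ring lra.

Set Implicit Arguments.
Unset Strict Implicit.
Unset Printing Implicit Defensive.

Import Order.TTheory GRing.Theory Num.Theory numFieldNormedType.Exports.
Local Open Scope classical_set_scope.
Local Open Scope ring_scope.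

(** * Series of extended reals started at an arbitrary index *)

Lemma eseries_tail_eq (R : realType) (N : nat) (f g : nat -> \bar R) :
  (forall k, (N <= k)%N -> f k = g k) ->
  (\sum_(N <= k <oo) f k = \sum_(N <= k <oo) g k)%E.
Proof.
move=> fg; rewrite eseries_cond [RHS]eseries_cond; apply: eq_eseriesr => k.
exact: fg.
Qed.

Lemma nneseries_tail_le (R : realType) (N : nat) (f g : nat -> \bar R) :
  (forall k, (N <= k)%N -> 0 <= f k)%E ->
  (forall k, (N <= k)%N -> f k <= g k)%E ->
  (\sum_(N <= k <oo) f k <= \sum_(N <= k <oo) g k)%E.
Proof.
move=> f0 fg; rewrite eseries_cond [leRHS]eseries_cond.
by apply: lee_nneseries => k => [_|]; [exact: f0 | exact: fg].
Qed.

Lemma nneseries_tailZl (R : realType) (N : nat) (f : nat -> \bar R) (x : R) :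
  (forall k, (N <= k)%N -> 0 <= f k)%E ->
  (\sum_(N <= k <oo) x%:E * f k = x%:E * \sum_(N <= k <oo) f k)%E.
Proof.
move=> f0; rewrite [in RHS]eseries_cond -nneseriesZl; last exact: f0.
by rewrite eseries_cond.
Qed.

Lemma nneseries_tail_interchange (R : realType) (N : nat)
    (f : nat -> nat -> \bar R) :
  (forall i j, (N <= i)%N -> (N <= j)%N -> 0 <= f i j)%E ->
  (\sum_(N <= i <oo) \sum_(N <= j <oo) f i j =
   \sum_(N <= j <oo) \sum_(N <= i <oo) f i j)%E.
Proof.
(* The sign of [f] is known only for indices from [N] on; [g] vanishes elsewhere, so it is
   nonnegative everywhere and the two sums can be exchanged. *)
move=> f0; pose g i j := if (N <= i)%N && (N <= j)%N then f i j else 0%E.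
transitivity (\sum_(N <= i <oo) \sum_(N <= j <oo) g i j)%E.
  apply: eseries_tail_eq => i Ni; apply: eseries_tail_eq => j Nj.
  by rewrite /g Ni Nj.
transitivity (\sum_(N <= j <oo) \sum_(N <= i <oo) g i j)%E; last first.
  apply: eseries_tail_eq => i Ni; apply: eseries_tail_eq => j Nj.
  by rewrite /g Ni Nj.
under eq_eseriesr do rewrite eseries_cond.
under [RHS]eq_eseriesr do rewrite eseries_cond.
rewrite eseries_cond [RHS]eseries_cond nneseries_interchange// => i j.
by rewrite /g; case: ifP => // /andP[]; exact: f0.
Qed.

(** The partial sum on the left up to [n] is the one on the right up to [n + k], and a shift of the
    index does not change the limit. *)
Lemma nneseries_tail_addn (R : realType) (N k : nat) (f : nat -> \bar R) :
  (forall i, (N + k <= i)%N -> 0 <= f i)%E ->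
  (\sum_(N <= i <oo) f (i + k)%N = \sum_(N + k <= i <oo) f i)%E.
Proof.
move=> f0; apply/cvg_lim => //.
suff -> : (fun n => \sum_(N <= i < n) f (i + k)%N)%E =
    (fun n => \sum_(N + k <= i < n + k) f i)%E.
  rewrite (cvg_shiftn k (fun n => \sum_(N + k <= i < n) f i)%E).
  by apply: is_cvg_nneseries => i + _; exact: f0.
by apply/funext => n; rewrite big_addn addnK.
Qed.

(** Sum by columns and cut column [k] at the diagonal: the entries [j <= k] form a finite sum, and
    those below are reached by the shift from [j] to [j + k]. With [b] the reaction rates, the
    shifted part is the total gain. *)
Lemma nneseries_split_diagonal (R : realType) (b : nat -> nat -> R) :
  (forall j k, (0 < j)%N -> (0 < k)%N -> 0 <= b j k) ->
  (\sum_(1 <= j <oo) \sum_(1 <= k <oo) (b j k)%:E =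
   \sum_(1 <= k <oo) (\sum_(1 <= j < k.+1) b j k)%R%:E +
   \sum_(1 <= j <oo) \sum_(1 <= k <oo) (b (j + k)%N k)%:E)%E.
Proof.
move=> b0.
rewrite [LHS]nneseries_tail_interchange; last first.
  by move=> i j i0 j0; rewrite lee_fin b0.
rewrite [X in (_ + X)%E]nneseries_tail_interchange; last first.
  by move=> i j i0 j0; rewrite lee_fin b0// addn_gt0 i0.
rewrite -nneseriesD; last 2 first.
- move=> k k0 _; rewrite lee_fin big_nat sumr_ge0// => j /andP[j0 _].
  exact: b0.
- move=> k k0 _; apply: nneseries_ge0 => j j0 _.
  by rewrite lee_fin b0// addn_gt0 j0.
apply: eseries_tail_eq => k k0.
rewrite (nneseries_split 1 k); last by move=> j j0; rewrite lee_fin b0.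
congr (_ + _)%E; first by rewrite add1n sumEFin.
by rewrite -nneseries_tail_addn// => j j0; rewrite lee_fin b0// (leq_trans _ j0).
Qed.

(** * Continuity, differentiation and integration of limits *)

(** A finite sum of continuous functions approximates the series up to a tail that is uniformly
    small near [s0]. Tails are controlled on half-lines [s <= T], which suits paths that are
    constant at negative times. *)
Lemma nneseries_continuous (R : realType) (u w : nat -> R -> R) :
  (forall k, (0 < k)%N -> continuous (u k)) ->
  (forall k s, (0 < k)%N -> 0 <= u k s <= w k s) ->
  (forall T e, 0 < e -> exists N, forall s, s <= T ->
    (\sum_(N.+1 <= k <oo) (w k s)%:E <= e%:E)%E) ->
  continuous (fun s => fine (\sum_(1 <= k <oo) (u k s)%:E)).
Proof.
move=> cu uw wtail s0; apply/cvgrPdist_le => e e0.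
have e3 : 0 < e / 3 by rewrite divr_gt0.
(* The half-line up to [s0 + 1] is a neighbourhood of [s0], so one [N] serves for all nearby [s]. *)
have [N HN] := wtail (s0 + 1) _ e3.
have u0 k s : (0 < k)%N -> (0 <= (u k s)%:E)%E.
  by move=> k0; rewrite lee_fin; have /andP[] := uw k s k0.
pose S s := \sum_(1 <= k < N.+1) u k s.
have uE s : s <= s0 + 1 ->
    `|fine (\sum_(1 <= k <oo) (u k s)%:E) - S s| <= e / 3.
  move=> ss0; rewrite (nneseries_split 1 N); last by move=> k; exact: u0.
  rewrite add1n sumEFin.
  have t0 : (0 <= \sum_(N.+1 <= k <oo) (u k s)%:E)%E.
    by apply: nneseries_ge0 => k Nk _; apply: u0; exact: leq_ltn_trans Nk.
  have te : (\sum_(N.+1 <= k <oo) (u k s)%:E <= (e / 3)%:E)%E.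
    apply: le_trans (HN s ss0); apply: nneseries_tail_le => k Nk.
      by apply: u0; exact: leq_ltn_trans Nk.
    by rewrite lee_fin; have /andP[] := uw k s (leq_ltn_trans (leq0n _) Nk).
  (* Lying between [0] and [e / 3], the tail is a real number, so [fine] is additive here. *)
  move: t0 te; case: (\sum_(N.+1 <= k <oo) _)%E => [r| |]//=.
  by rewrite !lee_fin addrAC subrr add0r => r0 re; rewrite ger0_norm.
have cS : S s @[s --> s0] --> S s0.
  rewrite /S big_nat; under eq_fun do rewrite big_nat.
  by apply: cvg_big => [|k /andP[k0 _]]; [exact: add_continuous | exact: cu].
near=> s.
have ss0 : s <= s0 + 1.
  by apply: ltW; near: s; apply: lt_nbhsl; rewrite ltrDl.
have /ler_normlP : `|S s0 - S s| <= e / 3.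
  by near: s; move/cvgrPdist_le : cS; apply.
have /ler_normlP := uE s ss0.
have /ler_normlP : `|fine (\sum_(1 <= k <oo) (u k s0)%:E) - S s0| <= e / 3.
  by apply: uE; rewrite lerDl.
by move=> [? ?] [? ?] [? ?]; apply/ler_normlP; split; lra.
Unshelve. all: by end_near.
Qed.

(* Integrating from [-1] makes the primitive two-sidedly differentiable at [0]. *)
Lemma is_derive_nneg_integral (R : realType) (f g : R -> R) (g0 : R) :
  continuous f ->
  (forall t : R, 0 <= t -> (g t)%:E =
    (g0%:E + \int[lebesgue_measure]_(s in `[0%R, t]) (f s)%:E)%E) ->
  forall t, 0 <= t -> is_derive_nneg g t (f t).
Proof.
move=> cf gE.
have intf a b : lebesgue_measure.-integrable `[a, b] (EFin \o f).
  apply: continuous_compact_integrable; first exact: segment_compact.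
  exact: continuous_subspaceT.
pose F (x : R) : R := \int[lebesgue_measure]_(s in `[-1, x]) f s.
have dF (x : R) : 0 <= x -> is_derive x 1 F (f x).
  move=> x0.
  (* With the right end beyond [x], the point [x] is interior and the derivative is two-sided. *)
  have x1 : x < x + 1 by rewrite ltrDl.
  have m1x : ((BLeft (-1)%R : \bar R) < (BRight x : \bar R))%E.
    by rewrite /= lte_fin; lra.
  have [dF FE] := @continuous_FTC1 R f (BLeft (-1)) x _ x1 (intf _ _) m1x (cf x).
  by rewrite derive1E in FE; exact: (DeriveDef dF FE).
(* The constant makes [G] agree with [g] on nonnegative times; the values of [g] at negative times
   are unknown, so derivatives are taken of [G] and then transferred. *)
pose G : R -> R := F \+ cst (g0 - F 0).
have dG (x : R) : 0 <= x -> is_derive x 1 G (f x).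
  move=> x0; rewrite -[f x]addr0; apply: is_deriveD; first exact: dF.
have gG (x : R) : 0 <= x -> g x = G x.
  move=> x0; apply: EFin_inj; rewrite gE//.
  have -> : (\int[lebesgue_measure]_(s in `[0%R, x]) (f s)%:E =
      (F x - F 0)%:E)%E.
    rewrite Rintegral_itvB; [|exact: intf|by rewrite bnd_simp; lra|by []].
    rewrite Rintegral_itv_obnd_cbnd; last first.
      apply: (integrableS _ _ _ (intf 0 x)) => //.
      by apply: subset_itvr; rewrite bnd_simp.
    by rewrite /Rintegral fineK//; apply: integrable_fin_num => //; exact: intf.
  by rewrite -EFinD addrCA.
move=> t t0; split => // [t_gt0|t_eq0].
  apply: near_eq_is_derive (dG _ t0); near=> s; rewrite gG//.
  by apply: ltW; near: s; exact: lt_nbhsr.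
rewrite t_eq0 in t0 *; have [dG0 dG0E] := dG _ t0.
(* At [0] the two-sided limit for [G] is restricted to [h > 0], where both difference quotients
   coincide. *)
have : h^-1 *: (G (h *: 1 + 0) - G 0) @[h --> 0^'] --> f 0.
  by rewrite -dG0E; exact: dG0.
move/cvg_dnbhs_at_right; apply: cvg_trans; apply: near_eq_cvg.
near=> h; rewrite !gG//.
by rewrite addr0 [_ *: 1]mulr1.
Unshelve. all: by end_near.
Qed.

(** Dominated convergence for the partial sums of the integrands. The [f j] may change sign, so it
    is the partial sums that are bounded, by a constant, and not the series of absolute values. *)
Lemma nneseries_integral (R : realType) (f : nat -> R -> R) (F : R -> R)
    (y y0 : nat -> R) (t L : R) :
  (forall j, (0 < j)%N -> continuous (f j)) ->
  (forall j, (0 < j)%N -> 0 <= y0 j) ->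
  (\sum_(1 <= j <oo) (y0 j)%:E < +oo)%E ->
  (forall j, (0 < j)%N -> (y j)%:E =
    ((y0 j)%:E + \int[lebesgue_measure]_(s in `[0%R, t]) (f j s)%:E)%E) ->
  (forall n s, `|\sum_(1 <= j < n) f j s| <= L) ->
  (forall s, (\sum_(1 <= j < n) f j s)%:E @[n --> \oo] --> (F s)%:E) ->
  (\sum_(1 <= j <oo) (y j)%:E = \sum_(1 <= j <oo) (y0 j)%:E +
    \int[lebesgue_measure]_(s in `[0%R, t]) (F s)%:E)%E.
Proof.
move=> cf y00 y0fin yE fL fF.
have intc (h : R -> R) : continuous h ->
    lebesgue_measure.-integrable `[0, t] (EFin \o h).
  move=> ch; apply: continuous_compact_integrable; first exact: segment_compact.
  exact: continuous_subspaceT.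
have y0ge0 j : (1 <= j)%N -> true -> (0 <= (y0 j)%:E)%E.
  by move=> j0 _; rewrite lee_fin y00.
have intE n : (\int[lebesgue_measure]_(s in `[0%R, t])
      (\sum_(1 <= j < n) f j s)%:E =
    \sum_(1 <= j < n) \int[lebesgue_measure]_(s in `[0%R, t]) (f j s)%:E)%E.
  rewrite big_add1 -integral_sum//; last by move=> j; apply: intc; exact: cf.
  by apply: eq_integral => s _; rewrite -sumEFin big_add1.
apply/cvg_lim => //.
have -> : (fun n => \sum_(1 <= j < n) (y j)%:E)%E =
    (fun n => \sum_(1 <= j < n) (y0 j)%:E +
      \int[lebesgue_measure]_(s in `[0%R, t]) (\sum_(1 <= j < n) f j s)%:E)%E.
  apply/funext => n; rewrite intE -big_split /=.
  by apply: eq_big_nat => j /andP[j0 _]; exact: yE.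
apply: cvgeD.
- by rewrite fin_num_adde_defr// ge0_fin_numE// nneseries_ge0.
- exact: is_cvg_nneseries.
- apply: (@dominated_cvg _ _ _ _ _ _ _ _ (cst L%:E)) => //.
  + move=> n; suff /intc/measurable_int :
        continuous (fun s => \sum_(1 <= j < n) f j s) by [].
    move=> s; rewrite /continuous_at big_nat; under eq_fun do rewrite big_nat.
    by apply: cvg_big => [|j /andP[j0 _]]; [exact: add_continuous | exact: cf].
  + by apply: (intc (cst L)) => s; exact: cvg_cst.
  + by move=> n s _; rewrite lee_fin fL.
Qed.

(** * Paths whose mass has uniformly small tails *)

(* Admissibility enters the proof only through the last clause. *)
Definition tight_path (R : realType) (C : R -> nat -> R) (M : R) : Prop :=
  [/\ forall j, (0 < j)%N -> continuous (C ^~ j),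
      forall s j, (0 < j)%N -> 0 <= C s j,
      forall s, (\sum_(1 <= k <oo) (k%:R * C s k)%:E <= M%:E)%E
    & forall T e, 0 < e -> exists N, forall s, s <= T ->
        (\sum_(N.+1 <= k <oo) (k%:R * C s k)%:E <= e%:E)%E].

(** The mass series dominates [u] up to the factor [L], so its total bounds the sum and its uniform
    tails give continuity. *)
Lemma tight_path_series (R : realType) (C : R -> nat -> R) (M L : R)
    (u : nat -> R -> R) :
  tight_path C M -> 0 <= L -> (forall k, (0 < k)%N -> continuous (u k)) ->
  (forall k s, (0 < k)%N -> 0 <= u k s <= L * (k%:R * C s k)) ->
  (forall s, 0 <= \sum_(1 <= k <oo) (u k s)%:E <= (L * M)%:E)%E /\
  continuous (fun s => fine (\sum_(1 <= k <oo) (u k s)%:E)).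
Proof.
move=> [_ C0 CM Ctail] L0 cu uL.
have kC0 s k : (0 < k)%N -> (0 <= (k%:R * C s k)%:E)%E.
  by move=> k0; rewrite lee_fin mulr_ge0// C0.
have sumL N s : (\sum_(N.+1 <= k <oo) (L * (k%:R * C s k))%:E =
    L%:E * \sum_(N.+1 <= k <oo) (k%:R * C s k)%:E)%E.
  rewrite -nneseries_tailZl; last first.
    by move=> k k0; apply: kC0; exact: leq_ltn_trans k0.
  by under eq_eseriesr do rewrite EFinM.
split=> [s|]; last first.
  apply: (@nneseries_continuous _ u (fun k s => L * (k%:R * C s k))) => //.
  (* Dividing by [L + 1] instead of [L] covers [L = 0], and [L * (e / (L + 1)) <= e] still holds. *)
  move=> T e e0; have [|N HN] := Ctail T (e / (L + 1)).
    by rewrite divr_gt0// ltr_wpDl.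
  exists N => s sT; rewrite sumL.
  apply: (@le_trans _ _ (L%:E * (e / (L + 1))%:E)%E).
    by apply: lee_wpmul2l; [rewrite lee_fin | exact: HN].
  rewrite lee_fin mulrCA -[leRHS]mulr1 ler_wpM2l ?(ltW e0)//.
  by rewrite ler_pdivrMr ?mul1r ?lerDl// ltr_wpDl.
apply/andP; split.
  by apply: nneseries_ge0 => k k0 _; rewrite lee_fin; have /andP[] := uL k s k0.
apply: (@le_trans _ _ (\sum_(1 <= k <oo) (L * (k%:R * C s k))%:E)%E).
  apply: nneseries_tail_le => k k0; rewrite lee_fin;
  by have /andP[] := uL k s k0.
rewrite sumL EFinM; apply: lee_wpmul2l; first by rewrite lee_fin.
exact: CM.
Qed.

Lemma tight_path_partial (R : realType) (C : R -> nat -> R) (M : R) n s :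
  tight_path C M -> \sum_(1 <= k < n) k%:R * C s k <= M.
Proof.
move=> [_ C0 CM _]; rewrite -lee_fin; apply: le_trans (CM s).
rewrite -sumEFin; apply: nneseries_lim_ge => k k0 _.
by rewrite lee_fin mulr_ge0// C0.
Qed.

Lemma tight_path_term (R : realType) (C : R -> nat -> R) (M : R) k s :
  tight_path C M -> (0 < k)%N -> k%:R * C s k <= M.
Proof.
move=> tC k0; apply: le_trans (tight_path_partial k.+1 s tC).
rewrite big_nat_recr//= lerDr big_nat sumr_ge0// => j /andP[j0 _].
by case: tC => _ C0 _ _; rewrite mulr_ge0// C0.
Qed.

(** * Gain and loss rates along a tight path *)

Definition gain (R : realType) (a : nat -> nat -> R) (x : nat -> R) j : \bar R :=
  (\sum_(1 <= k <oo) (a (j + k)%N k * x (j + k)%N * x k)%:E)%E.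

Definition loss (R : realType) (a : nat -> nat -> R) (x : nat -> R) j : \bar R :=
  (\sum_(1 <= k <oo) (a j k * x j * x k)%:E)%E.

(** Only the pairs [j <= k] are counted: this is what is left of the double sum of all losses once
    the gains, which are its part [j > k], have been removed. *)
Definition total_loss (R : realType) (a : nat -> nat -> R)
    (x : nat -> R) : \bar R :=
  (\sum_(1 <= k <oo) (\sum_(1 <= j < k.+1) a j k * x j * x k)%R%:E)%E.

Definition mass_kernel_bound (R : realType) (a : nat -> nat -> R) (K : R) :=
  forall j k, (0 < j)%N -> (0 < k)%N -> 0 <= a j k <= K * j%:R * k%:R.

(** The weights [j] and [k] of the kernel bound are absorbed into the two masses, so every later
    estimate uses only the first moment. *)
Lemma reaction_bound (R : realType) (a : nat -> nat -> R) (K M : R)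
    (C : R -> nat -> R) j k s :
  mass_kernel_bound a K -> tight_path C M -> (0 < j)%N -> (0 < k)%N ->
  0 <= a j k * C s j * C s k <= K * (j%:R * C s j) * (k%:R * C s k).
Proof.
move=> aK [_ C0 _ _] j0 k0; have /andP[a0 aE] := aK j k j0 k0.
rewrite !mulr_ge0 ?C0//=.
have -> : K * (j%:R * C s j) * (k%:R * C s k) =
  (K * j%:R * k%:R) * (C s j * C s k) by ring.
by rewrite -mulrA ler_wpM2r// mulr_ge0// C0.
Qed.

Lemma reaction_continuous (R : realType) (a : nat -> nat -> R) (M : R)
    (C : R -> nat -> R) j k :
  tight_path C M -> (0 < j)%N -> (0 < k)%N ->
  continuous (fun s => a j k * C s j * C s k).
Proof.
move=> [cC _ _ _] j0 k0 s; apply: cvgM; last exact: cC.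
by apply: cvgM; [exact: cvg_cst | exact: cC].
Qed.

Section rates.
Context (R : realType) (a : nat -> nat -> R) (K M : R) (C : R -> nat -> R).
Context (K0 : 0 <= K) (aK : mass_kernel_bound a K) (tC : tight_path C M).

Let C0 s j : (0 < j)%N -> 0 <= j%:R * C s j.
Proof. by case: tC => _ C0 _ _ j0; rewrite mulr_ge0// C0. Qed.

Lemma tight_path_bound_ge0 : 0 <= M.
Proof. by have := tight_path_partial 0 0 tC; rewrite big_geq. Qed.

Let M0 := tight_path_bound_ge0.

(** The mass carried by size [j + k] is at most [M], which leaves [K * M] times the mass carried by
    size [k]. *)
Lemma gain_bounded_continuous j : (0 < j)%N ->
  (forall s, 0 <= gain a (C s) j <= (K * M * M)%:E)%E /\
  continuous (fun s => fine (gain a (C s) j)).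
Proof.
move=> j0; apply: (tight_path_series (L := K * M)
  (u := fun k s => a (j + k)%N k * C s (j + k)%N * C s k) tC) => [|k k0|k s k0].
- by rewrite mulr_ge0.
- by apply: (reaction_continuous tC); rewrite ?addn_gt0 ?j0.
- have jk0 : (0 < j + k)%N by rewrite addn_gt0 j0.
  have /andP[-> rE] := reaction_bound s aK tC jk0 k0.
  apply: le_trans rE _; rewrite ler_wpM2r ?C0// ler_wpM2l//.
  exact: tight_path_term.
Qed.

Lemma loss_bounded_continuous j : (0 < j)%N ->
  (forall s, 0 <= loss a (C s) j <= (K * M * M)%:E)%E /\
  continuous (fun s => fine (loss a (C s) j)).
Proof.
move=> j0; apply: (tight_path_series (L := K * M)
  (u := fun k s => a j k * C s j * C s k) tC) => [|k k0|k s k0].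
- by rewrite mulr_ge0.
- exact: reaction_continuous tC j0 k0.
- have /andP[-> rE] := reaction_bound s aK tC j0 k0.
  apply: le_trans rE _; rewrite ler_wpM2r ?C0// ler_wpM2l//.
  exact: tight_path_term.
Qed.

(** Here the factor [M] bounds the whole inner sum of the masses [j * C s j] over [j <= k]. *)
Lemma total_loss_bounded_continuous :
  (forall s, 0 <= total_loss a (C s) <= (K * M * M)%:E)%E /\
  continuous (fun s => fine (total_loss a (C s))).
Proof.
apply: (tight_path_series (L := K * M)
  (u := fun k s => \sum_(1 <= j < k.+1) a j k * C s j * C s k) tC)
  => [|k k0|k s k0].
- by rewrite mulr_ge0.
- move=> s; rewrite /continuous_at big_nat; under eq_fun do rewrite big_nat.
  apply: cvg_big => [|j /andP[j0 _]]; first exact: add_continuous.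
  exact: (@reaction_continuous _ a _ _ _ _ tC j0 k0 s).
- rewrite big_nat sumr_ge0 => [/=|j /andP[j0 _]]; last first.
    by have /andP[] := reaction_bound s aK tC j0 k0.
  apply: (@le_trans _ _
      (\sum_(1 <= j < k.+1) K * (j%:R * C s j) * (k%:R * C s k))).
    rewrite [leRHS]big_nat ler_sum// => j /andP[j0 _].
    by have /andP[] := reaction_bound s aK tC j0 k0.
  rewrite -mulr_suml -mulr_sumr ler_wpM2r ?C0// ler_wpM2l//.
  exact: tight_path_partial.
Qed.

(** The dominating double series factors into [K] times the square of the mass. *)
Lemma sum_loss_le s : (\sum_(1 <= j <oo) loss a (C s) j <= (K * M * M)%:E)%E.
Proof.
have [_ _ CM _] := tC.
apply: (@le_trans _ _ (\sum_(1 <= j <oo) (K * M)%:E * (j%:R * C s j)%:E)%E).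
  apply: nneseries_tail_le => j j0; first by
    have [/(_ s)/andP[]] := loss_bounded_continuous j0.
  apply: (@le_trans _ _
      (\sum_(1 <= k <oo) (K * (j%:R * C s j))%:E * (k%:R * C s k)%:E)%E).
    apply: nneseries_tail_le => k k0; rewrite ?lee_fin;
    by have /andP[] := reaction_bound s aK tC j0 k0.
  rewrite nneseries_tailZl; last first.
    by move=> k k0; rewrite lee_fin C0.
  have -> : ((K * M)%:E * (j%:R * C s j)%:E = (K * (j%:R * C s j))%:E * M%:E)%E.
    by rewrite -!EFinM mulrAC.
  have Kj0 : (0 <= (K * (j%:R * C s j))%:E)%E by rewrite lee_fin mulr_ge0// C0.
  exact: lee_wpmul2l Kj0 _ _ (CM s).
rewrite nneseries_tailZl; last first.
  by move=> k k0; rewrite lee_fin C0.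
have KM0 : (0 <= (K * M)%:E)%E by rewrite lee_fin mulr_ge0.
by rewrite EFinM; exact: lee_wpmul2l KM0 _ _ (CM s).
Qed.

Lemma sum_loss_split s : (\sum_(1 <= j <oo) loss a (C s) j =
  total_loss a (C s) + \sum_(1 <= j <oo) gain a (C s) j)%E.
Proof.
apply: (nneseries_split_diagonal (b := fun j k => a j k * C s j * C s k)).
by move=> j k j0 k0; have /andP[] := reaction_bound s aK tC j0 k0.
Qed.

Lemma gain_fin s j : (0 < j)%N -> gain a (C s) j \is a fin_num.
Proof.
move=> j0; have [/(_ s)/andP[g0 gE] _] := gain_bounded_continuous j0.
by rewrite ge0_fin_numE//; exact: le_lt_trans gE (ltry _).
Qed.

Lemma loss_fin s j : (0 < j)%N -> loss a (C s) j \is a fin_num.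
Proof.
move=> j0; have [/(_ s)/andP[l0 lE] _] := loss_bounded_continuous j0.
by rewrite ge0_fin_numE//; exact: le_lt_trans lE (ltry _).
Qed.

Lemma RBK_rhsE s j : (0 < j)%N ->
  RBK_rhs a (C s) j = (fine (gain a (C s) j) - fine (loss a (C s) j))%:E.
Proof. by move=> j0; rewrite EFinB !fineK// ?gain_fin// loss_fin. Qed.

Lemma RBK_rhs_continuous j : (0 < j)%N ->
  continuous (fun s => fine (RBK_rhs a (C s) j)).
Proof.
move=> j0; under eq_fun do rewrite RBK_rhsE//.
move=> s; apply: cvgB; first exact: (gain_bounded_continuous j0).2.
exact: (loss_bounded_continuous j0).2.
Qed.

Let fine_RBK_rhs s j : (0 < j)%N ->
  fine (RBK_rhs a (C s) j) = fine (gain a (C s) j) - fine (loss a (C s) j).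
Proof. by move=> j0; rewrite RBK_rhsE. Qed.

Let gain_ge0 s j : (0 < j)%N -> (0 <= gain a (C s) j)%E.
Proof. by move=> j0; have [/(_ s)/andP[]] := gain_bounded_continuous j0. Qed.

Let loss_ge0 s j : (0 < j)%N -> (0 <= loss a (C s) j)%E.
Proof. by move=> j0; have [/(_ s)/andP[]] := loss_bounded_continuous j0. Qed.

(** The gains are part of the losses, and the remaining part is nonnegative. *)
Lemma sum_gain_le s : (\sum_(1 <= j <oo) gain a (C s) j <= (K * M * M)%:E)%E.
Proof.
apply: le_trans (sum_loss_le s); rewrite sum_loss_split leeDr//.
by have [/(_ s)/andP[]] := total_loss_bounded_continuous.
Qed.

(** Gains and losses are summed separately; in the difference of the limits the total gain
    cancels. *)
Lemma sum_RBK_rhs_cvg s :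
  (\sum_(1 <= j < n) fine (RBK_rhs a (C s) j))%:E @[n --> \oo] -->
  (- fine (total_loss a (C s)))%:E.
Proof.
have -> : (fun n => (\sum_(1 <= j < n) fine (RBK_rhs a (C s) j))%:E) =
    (fun n => \sum_(1 <= j < n) gain a (C s) j -
              \sum_(1 <= j < n) loss a (C s) j)%E.
  apply/funext => n; rewrite big_nat.
  under eq_bigr => j /andP[j0 _] do rewrite fine_RBK_rhs//.
  rewrite sumrB EFinB -!sumEFin [in RHS]big_nat [X in (_ = _ - X)%E]big_nat.
  congr (_ - _)%E; apply: eq_bigr => j /andP[j0 _]; rewrite fineK//.
    by rewrite gain_fin.
  by rewrite loss_fin.
(* In the extended reals this cancellation is legitimate because the total gain is finite. *)
have gfin : (\sum_(1 <= j <oo) gain a (C s) j)%E \is a fin_num.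
  rewrite ge0_fin_numE; first exact: le_lt_trans (sum_gain_le s) (ltry _).
  by apply: nneseries_ge0 => j j0 _; exact: gain_ge0.
have tfin : total_loss a (C s) \is a fin_num.
  have [/(_ s)/andP[t0 tE] _] := total_loss_bounded_continuous.
  by rewrite ge0_fin_numE//; exact: le_lt_trans tE (ltry _).
have -> : ((- fine (total_loss a (C s)))%:E =
    \sum_(1 <= j <oo) gain a (C s) j - \sum_(1 <= j <oo) loss a (C s) j)%E.
  by rewrite sum_loss_split fin_num_oppeD// addeCA subee// adde0 EFinN fineK.
apply: cvgeB.
- by rewrite fin_num_adde_defr.
- by apply: is_cvg_nneseries => j j0 _; exact: gain_ge0.
- by apply: is_cvg_nneseries => j j0 _; exact: loss_ge0.
Qed.

(** Both partial sums lie between [0] and [K * M * M], hence so does the absolute value of their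
    difference. This is the constant for dominated convergence. *)
Lemma sum_RBK_rhs_le n s :
  `|\sum_(1 <= j < n) fine (RBK_rhs a (C s) j)| <= K * M * M.
Proof.
rewrite big_nat; under eq_bigr => j /andP[j0 _] do rewrite fine_RBK_rhs//.
rewrite -big_nat sumrB.
have part_le (u : nat -> \bar R) : (forall j, (0 < j)%N -> (0 <= u j)%E) ->
    (forall j, (0 < j)%N -> u j \is a fin_num) ->
    (\sum_(1 <= j <oo) u j <= (K * M * M)%:E)%E ->
    0 <= \sum_(1 <= j < n) fine (u j) <= K * M * M.
  move=> u0 ufin uE; rewrite big_nat sumr_ge0 => [/=|j /andP[j0 _]]; last first.
    by rewrite fine_ge0// u0.
  rewrite -big_nat -lee_fin; apply: le_trans uE; rewrite -sumEFin big_nat.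
  under eq_bigr => j /andP[j0 _] do rewrite fineK ?ufin//.
  by rewrite -big_nat; apply: nneseries_lim_ge => j j0 _; exact: u0.
have /andP[? ?] := part_le _ (@gain_ge0 s) (@gain_fin s) (sum_gain_le s).
have /andP[? ?] := part_le _ (@loss_ge0 s) (@loss_fin s) (sum_loss_le s).
by apply/ler_normlP; split; lra.
Qed.
End rates.

(** * From admissible solutions to tight paths *)

Lemma time_domy (R : realType) (t : R) : time_dom +oo%E t <-> 0 <= t.
Proof. by split=> [[]//|t0]; split=> //; exact: ltry. Qed.

(** The continuous retraction [max 0] takes all its values in the time domain, so relative
    neighbourhoods pull back to ordinary ones. *)
Lemma within_time_dom_continuous (R : realType) (f : R -> R) :
  {within time_dom +oo%E, continuous f} ->
  continuous (fun s : R => f (Num.max 0 s)).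
Proof.
move=> /subspace_continuousP cf s.
have max0 (r : R) : time_dom +oo%E (Num.max 0 r).
  by apply/time_domy; rewrite le_max lexx.
have cmax : {for s, continuous (fun r : R => Num.max 0 r)}.
  apply: (@continuous_max R R (cst 0) id s); first exact: cst_continuous.
  exact: cvg_id.
apply: (@cvg_comp _ _ _ (fun r : R => Num.max 0 r) f _ _ _ _ (cf _ (max0 s))).
move=> P /= wP.
by apply: (@filterS _ (nbhs s) _ _ _ _ (cmax _ wP)) => r /= /(_ (max0 r)).
Qed.

Lemma admissible_tight_path (R : realType) (a : nat -> nat -> R)
    (c : R -> nat -> R) :
  admissible a c -> exists M, tight_path (fun s : R => c (Num.max 0 s)) M.
Proof.
move=> [[c0 [_ _ cX [cc cM] _]] [cN [_ cN0 cNc]]].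
have max0 (r : R) : 0 <= Num.max 0 r by rewrite le_max lexx.
have c_ge0 t j : 0 <= t -> (0 < j)%N -> 0 <= c t j.
  by move=> /time_domy /cX [_]; exact.
set S := ereal_sup _ in cM.
have normS t : 0 <= t -> (norm1 (c t) <= S)%E.
  by move=> t0; apply: ereal_sup_ubound; exists t => //; exact/time_domy.
have norm_ge0 (x : nat -> R) : (0 <= norm1 x)%E.
  by apply: nneseries_ge0 => j _ _; rewrite lee_fin mulr_ge0.
have Sfin : S \is a fin_num.
  by rewrite ge0_fin_numE //; exact: le_trans (norm_ge0 (c 0)) (normS _ (lexx 0)).
exists (fine S); split.
- by move=> j j0; exact: (within_time_dom_continuous (cc j j0)).
- by move=> s j; exact: c_ge0.
- move=> s; rewrite fineK//; apply: le_trans (normS _ (max0 s)).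
  apply: nneseries_tail_le => k k0; rewrite lee_fin ?mulr_ge0 ?c_ge0//.
  by rewrite ger0_norm// c_ge0.
move=> T e e0.
(* All [s <= T], negative ones included, are sent by [max 0] into this compact interval. *)
have sub : `[0, Num.max 0 T] `<=` `[0, +oo[.
  by move=> t /=; rewrite !in_itv/= andbT => /andP[].
have [N _ HN] := cNc _ (@segment_compact R 0 (Num.max 0 T)) sub e e0.
(* The approximants are constrained only for positive indices, hence [N.+1]. The solution [cN N.+1]
   vanishes beyond [N.+1], so from [N.+2] on the mass of [c] is part of the norm of the
   difference. *)
exists N.+1 => s sT; set t := Num.max 0 s.
have Bt : `[0, Num.max 0 T]%classic t.
  by rewrite /= in_itv/= max0 /= ge_max le_max lexx /= le_max sT orbT.
apply: le_trans (ltW (HN N.+1 (leqnSn N) t Bt)).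
rewrite /norm1 [leRHS](nneseries_split 1 N.+1); last first.
  by move=> k _; rewrite lee_fin mulr_ge0.
rewrite add1n; apply: (@le_trans _ _ (\sum_(N.+2 <= k <oo)
    (k%:R * `|cN N.+1 t k - c t k|)%:E)%E); last first.
  by rewrite leeDr// sume_ge0// => k _; rewrite lee_fin mulr_ge0.
have k0 k : (N.+1 < k)%N -> (0 < k)%N by exact: leq_ltn_trans.
apply: nneseries_tail_le => k Nk; rewrite lee_fin.
  by rewrite mulr_ge0// c_ge0 ?max0 ?k0.
by rewrite cN0// ?max0// sub0r normrN ger0_norm// c_ge0 ?max0 ?k0.
Qed.

(** * Differentiation of the integral equations for each [c_j] and for their sum *)

Theorem theorem6p1 (R : realType) (a : nat -> nat -> R)
    (ha : rate_coefficients a)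
    (hK : exists K : R, 0 < K /\
       forall j k, (0 < j)%N -> (0 < k)%N -> a j k <= K * j%:R * k%:R)
    (c : R -> nat -> R) (hc : admissible a c) :
  [/\ (forall j, (0 < j)%N -> C1_nneg (fun t => c t j)),
      C1_nneg (total_number c),
      (forall j t, (0 < j)%N -> 0 <= t ->
         exists d : R, is_derive_nneg (fun t => c t j) t d /\
           d%:E = RBK_rhs a (c t) j)
    & (forall t, 0 <= t ->
         exists d : R, is_derive_nneg (total_number c) t d /\
           (d%:E = - \sum_(1 <= k <oo)
                       (\sum_(1 <= j < k.+1) a j k * c t j * c t k)%R%:E)%E)].
Proof.
have [K [K_gt0 aK']] := hK; have K0 := ltW K_gt0.
have aK : mass_kernel_bound a K.
  by move=> j k j0 k0; rewrite aK'// andbT; have [] := ha j k j0 k0.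
have [M tC] := admissible_tight_path hc.
set C := fun s : R => c (Num.max 0 s) in tC.
have CE t : 0 <= t -> C t = c t by move=> t0; rewrite /C max_r.
have [[c0 [_ [c0X c0_ge0] cX _ [_ c_int]]] _] := hc.
pose f j s := fine (RBK_rhs a (C s) j).
have fE j s : (0 < j)%N -> RBK_rhs a (C s) j = (f j s)%:E.
  by move=> j0; rewrite /f (RBK_rhsE K0 aK tC).
have cf j : (0 < j)%N -> continuous (f j).
  exact: (RBK_rhs_continuous K0 aK tC).
have cE j t : (0 < j)%N -> 0 <= t -> (c t j)%:E =
    ((c0 j)%:E + \int[lebesgue_measure]_(s in `[0%R, t]) (f j s)%:E)%E.
  move=> j0 t0; rewrite c_int//; last exact/time_domy.
  (* Only times [s >= 0] enter the integral, and there [C s] is [c s]. *)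
  congr (_ + _)%E; apply: eq_integral => s.
  by rewrite inE /= in_itv /= => /andP[s0 _]; rewrite -fE// CE.
have dc j t : (0 < j)%N -> 0 <= t -> is_derive_nneg (c ^~ j) t (f j t).
  move=> j0; apply: (@is_derive_nneg_integral _ _ _ (c0 j)); first exact: cf.
  by move=> r; exact: cE.
pose F s := - fine (total_loss a (C s)).
have [tlE ctl] := total_loss_bounded_continuous K0 aK tC.
have cF : continuous F by move=> s; apply: cvgN; exact: ctl.
have sum_fin (x : nat -> R) : X1plus x ->
    (\sum_(1 <= j <oo) (x j)%:E)%E \is a fin_num.
  move=> [xfin x0]; rewrite ge0_fin_numE; last first.
    by apply: nneseries_ge0 => j j0 _; rewrite lee_fin x0.
  (* The number of clusters is at most the mass, since [j >= 1]. *)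
  apply: le_lt_trans xfin; apply: nneseries_tail_le => j j0;
    rewrite lee_fin ?x0//.
  by rewrite ger0_norm ?x0// ler_peMl ?x0// ler1n.
have totE t : 0 <= t -> (total_number c t)%:E =
    ((fine (\sum_(1 <= j <oo) (c0 j)%:E))%:E +
      \int[lebesgue_measure]_(s in `[0%R, t]) (F s)%:E)%E.
  move=> t0; rewrite /total_number !fineK ?sum_fin//; last first.
    by apply: cX; exact/time_domy.
  apply: (@nneseries_integral _ f F _ _ _ (K * M * M)) => //.
  - by rewrite ltey_eq sum_fin.
  - by move=> j j0; exact: cE.
  - by move=> n s; exact: (sum_RBK_rhs_le K0 aK tC).
  - by move=> s; exact: (sum_RBK_rhs_cvg K0 aK tC).
have dtot t : 0 <= t -> is_derive_nneg (total_number c) t (F t).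
  by apply: is_derive_nneg_integral => //; exact: totE.
split.
- move=> j j0; exists (f j); split; first by move=> t; exact: dc.
  by apply: continuous_subspaceT; exact: cf.
- by exists F; split => //; exact: continuous_subspaceT.
- by move=> j t j0 t0; exists (f j t); split; [exact: dc | rewrite -fE// CE].
- move=> t t0; exists (F t); split; first exact: dtot.
  have := tlE t; rewrite /F CE// EFinN => /andP[tl0 tlM].
  (* The total loss is bounded, so the [fine] in [F] does not alter it. *)
  by rewrite fineK// ge0_fin_numE//; exact: le_lt_trans tlM (ltry _).
Qed.
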